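(* Let $n\ge1$. There is a bijection between the set of Frobenius $n$-homomorphisms $\varphi\colon A\to B$ and the set of unital algebra homomorphisms $F\colon S^nA\to B$, characterized by the identity $$F\bigl(\det(1+\Lambda(a)z)\bigr)=R_\varphi(a,z)\quad\text{for all }a\in A$$ (identically in $z$). Explicitly: given $F$, the corresponding $\varphi$ is $\varphi(a)=F(a\otimes1\otimes\cdots\otimes1+1\otimes a\otimes1\otimes\cdots\otimes1+\dots+1\otimes\cdots\otimes1\otimes a)$; given $\varphi$, the corresponding $F$ is determined by $F(a\otimes a\otimes\cdots\otimes a)=\psi_n(a)$ for all $a\in A$, equivalently $F(\mathrm{Sym}(a_1\otimes\cdots\otimes a_n))=\frac1{n!}\Phi_n(a_1,\dots,a_n)$ for all $a_1,\dots,a_n\in A$.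
   Context: $\mathbb{K}=\mathbb{R}$ or $\mathbb{C}$; $A$ and $B$ are commutative associative unital $\mathbb{K}$-algebras. For a $\mathbb{K}$-linear map $\varphi\colon A\to B$ and $a\in A$, the characteristic function is $R_\varphi(a,z)=\exp\bigl(\varphi(\ln(1+az))\bigr)=1+\sum_{k\ge1}\psi_k(a)z^k\in B[[z]]$, with $\ln(1+az)=\sum_{k\ge1}(-1)^{k+1}a^kz^k/k$ and $\varphi$ applied coefficientwise. The Frobenius maps $\Phi_k\colon A^k\to B$ of $\varphi$ are defined by $\Phi_1=\varphi$ and $\Phi_{k+1}(a_1,\dots,a_{k+1})=\varphi(a_1)\Phi_k(a_2,\dots,a_{k+1})-\sum_{j=2}^{k+1}\Phi_k(a_2,\dots,a_{j-1},a_1a_j,a_{j+1},\dots,a_{k+1})$. A linear map $\varphi$ is a (Frobenius) $n$-homomorphism if $\varphi(1)=n\cdot1_B$ and $\Phi_k\equiv0$ for all $k\ge n+1$. $S^nA\subset A^{\otimes n}$ is the subspace of tensors invariant under permutation of factors, a subalgebra of $A^{\otimes n}$ with the induced multiplication; $\mathrm{Sym}(a_1\otimes\cdots\otimes a_n)=\frac1{n!}\sum_{\sigma\in S_n}a_{\sigma(1)}\otimes\cdots\otimes a_{\sigma(n)}$. $\Lambda(a)$ is the $n\times n$ diagonal matrix with entries in $A^{\otimes n}$ whose $i$-th diagonal entry is $1\otimes\cdots\otimes a\otimes\cdots\otimes1$ ($a$ in the $i$-th slot); the coefficients of $\det(1+\Lambda(a)z)=\prod_{i=1}^n(1+(1\otimes\cdots\otimes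 a\otimes\cdots\otimes1)z)$ lie in $S^nA$, and $F$ is applied coefficientwise. *)

(* Defs.v *)
From HB Require Import structures.
From mathcomp Require Import all_boot all_order all_fingroup all_algebra.
Set Implicit Arguments. Unset Strict Implicit. Unset Printing Implicit Defensive.
Import Order.TTheory GRing.Theory Num.Theory.
Local Open Scope ring_scope.

Section FrobDefs.
Variables (K : numFieldType) (A B : comAlgType K) (n : nat).

Definition tupd (x : n.-tuple A) (i : 'I_n) (u : A) : n.-tuple A :=
  [tuple if j == i then u else tnth x j | j < n].

Definition tperm (s : 'S_n) (x : n.-tuple A) : n.-tuple A :=
  [tuple tnth x (s j) | j < n].

Definition multilinear (V : lmodType K) (f : n.-tuple A -> V) : Prop :=
  forall (i : 'I_n) (x : n.-tuple A) (c : K) (u v : A),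
    f (tupd x i (c *: u + v)) = c *: f (tupd x i u) + f (tupd x i v).

Record tensor_power := TensorPower {
  tp_carrier :> comAlgType K;
  tp_tens : n.-tuple A -> tp_carrier;
  tp_multilinear : multilinear tp_tens;
  tp_mul : forall x y : n.-tuple A,
      tp_tens [tuple tnth x i * tnth y i | i < n] = tp_tens x * tp_tens y;
  tp_one : tp_tens [tuple (1 : A) | _ < n] = 1;
  tp_span : forall t : tp_carrier, exists s : seq (K * n.-tuple A),
      t = \sum_(p <- s) p.1 *: tp_tens p.2;
  tp_universal_ex : forall (V : lmodType K) (f : n.-tuple A -> V),
      multilinear f -> exists g : {linear tp_carrier -> V},
        forall x, g (tp_tens x) = f x;
  tp_universal_uniq : forall (V : lmodType K) (g1 g2 : {linear tp_carrier -> V}),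
      (forall x, g1 (tp_tens x) = g2 (tp_tens x)) -> g1 =1 g2
}.

Variable TP : tensor_power.
Local Notation tens := (@tp_tens TP).

Definition symmetric_tensor (t : TP) : Prop :=
  forall (s : 'S_n) (g : {linear TP -> TP}),
    (forall x, g (tens x) = tens (tperm s x)) -> g t = t.

(* F : S^n A -> B is a unital K-algebra homomorphism (F is given as a
   function on A^{\otimes n}; only its restriction to S^n A matters) *)
Definition symalg_hom (F : TP -> B) : Prop :=
  [/\ F 1 = 1,
      forall t u, symmetric_tensor t -> symmetric_tensor u -> F (t + u) = F t + F u,
      forall (c : K) t, symmetric_tensor t -> F (c *: t) = c *: F t &
      forall t u, symmetric_tensor t -> symmetric_tensor u -> F (t * u) = F t * F u].

Definition slot (i : 'I_n) (a : A) : TP := tens (tupd [tuple (1 : A) | _ < n] i a).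

Definition Symm (x : n.-tuple A) : TP :=
  (n`!%:R : K)^-1 *: \sum_(s : 'S_n) tens (tperm s x).

Definition detLambda (a : A) : {poly TP} :=
  \det (1%:M + diag_mx (\row_(i < n) ((slot i a)%:P * 'X))).

Definition phi_of (F : TP -> B) (a : A) : B := F (\sum_(i < n) slot i a).

End FrobDefs.

Section Frobenius.
Variables (K : numFieldType) (A B : comAlgType K).

Fixpoint Frob (phi : A -> B) (k : nat) (s : seq A) : B :=
  match k with
  | 0 => 1
  | k'.+1 =>
    match s with
    | [::] => 0
    | a :: t => phi a * Frob phi k' t
                - \sum_(j < size t) Frob phi k' (set_nth 0 t j (a * nth 0 t j))
    end
  end.

Definition n_hom (n : nat) (phi : A -> B) : Prop :=
  phi 1 = n%:R /\ forall k, (n < k)%N -> forall s : k.-tuple A, Frob phi k s = 0.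

(* the truncation of phi(ln(1 + a z)) modulo z^{k+1} *)
Definition logpoly (phi : A -> B) (a : A) (k : nat) : {poly B} :=
  \poly_(i < k.+1)
    (if i == 0%N then 0 else (((-1) ^+ i.+1 / i%:R : K) *: phi (a ^+ i))).

(* psi_k(a) = k-th coefficient of R_phi(a,z) = exp(phi(ln(1+az))) *)
Definition psi (phi : A -> B) (k : nat) (a : A) : B :=
  \sum_(m < k.+1) ((m`!%:R : K)^-1 *: ((logpoly phi a k) ^+ m)`_k).

Definition char_identity (n : nat) (TP : tensor_power A n) (phi : A -> B)
  (F : TP -> B) : Prop :=
  forall (a : A) (k : nat), F ((detLambda TP a)`_k) = psi phi k a.

End Frobenius.

(* Main.v *)
Require Import Defs.
From HB Require Import structures.
From mathcomp Require Import all_boot all_order all_fingroup all_algebra.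
From mathcomp Require Import zify.
Set Implicit Arguments.
Unset Strict Implicit.
Unset Printing Implicit Defensive.
Import Order.TTheory GRing.Theory Num.Theory.
Local Open Scope ring_scope.

(** Let phi_0 a be the sum of all [slot i a].  The slots are multiplicative, so
    Frob phi_0 k (a_1, ..., a_k) is the sum of the products of [slot (f j) a_j]
    over all injections f : {1..k} -> {1..n}: it vanishes for k > n and equals
    n! Sym(a_1, ..., a_n) for k = n.  A homomorphism F on symmetric tensors
    therefore yields the n-homomorphism F \o phi_0.
    Conversely, let G be the linear map sending a pure tensor to its Frobenius
    map Phi_n.  For an n-homomorphism phi, the recursion and Phi_(n+1) = 0 give
    G (phi_0 a * t) = phi a * G t, hence G (n! Sym x * t) = Phi_n(x) * G t; so
    F = G / n! is multiplicative on S^n A, with no need for the symmetry of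
    Phi_n.  The characteristic identity holds because the elementary symmetric
    polynomials of the slots and the psi_k obey the same Newton recursion. *)

(** * Frobenius maps: multilinearity and values at units *)

Section FrobeniusMaps.
Variables (K : numFieldType) (A B : comAlgType K).
Implicit Types (phi : A -> B) (s : seq A).

Lemma eq_Frob phi phi' : phi =1 phi' -> forall k, Frob phi k =1 Frob phi' k.
Proof.
move=> e; elim=> // k IH [|a s] //=; rewrite e IH; congr (_ - _).
by apply: eq_bigr => j _; rewrite IH.
Qed.

(** The head enters each correction term through a single merged entry, so linearity in it follows
    from linearity of the shorter map in that entry; any other entry is at most multiplied by the
    head. *)
Lemma Frob_linear_nth (phi : {linear A -> B}) k s i c u v :
  size s = k -> (i < k)%N ->
  Frob phi k (set_nth 0 s i (c *: u + v)) =
  c *: Frob phi k (set_nth 0 s i u) + Frob phi k (set_nth 0 s i v).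
Proof.
elim: k s i u v => // k IH [|a s] // i u v /= [sz].
case: i => [_|i ltik] /=.
  rewrite linearP mulrDl scalerBr -scalerAl addrACA; congr (_ + _).
  rewrite -opprD; congr (- _).
  rewrite scaler_sumr -big_split /=; apply: eq_bigr => j _.
  by rewrite mulrDl -scalerAl IH // -sz.
have Es w : size (set_nth 0 s i w) = k by rewrite size_set_nth sz; apply/maxn_idPr.
rewrite IH // mulrDr scalerBr -scalerAr addrACA; congr (_ + _).
rewrite -opprD; congr (- _).
rewrite scaler_sumr !Es -big_split /=; apply: eq_bigr => j _.
rewrite !nth_set_nth /= !(set_set_nth _ _ i) ![i == j]eq_sym.
have [_|_] := eqVneq (j : nat) i; first by rewrite mulrDr -scalerAr IH // sz.
by rewrite IH // size_set_nth sz; apply/maxn_idPr.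
Qed.

(** Merging ones changes nothing, so each step of the recursion multiplies by n - k; the bound keeps
    this truncated subtraction exact. *)
Lemma Frob_nseq1 n phi k : phi 1 = n%:R -> (k <= n)%N ->
  Frob phi k (nseq k 1) = (n ^_ k)%:R.
Proof.
move=> phi1; elim: k => [|k IH] // lkn.
have step j : (j < k)%N ->
    set_nth 0 (nseq k 1) j (1 * (nseq k 1)`_j) = nseq k 1 :> seq A.
  move=> ltj; apply: (@eq_from_nth _ 0) => [|i].
    by rewrite size_set_nth size_nseq; apply/maxn_idPr.
  rewrite size_set_nth size_nseq (maxn_idPr ltj) => ltik.
  rewrite nth_set_nth /= !nth_nseq ltj ltik mul1r; exact: if_same.
rewrite /= phi1 size_nseq (eq_bigr (fun=> Frob phi k (nseq k 1))); last first.
  by move=> j _; rewrite step.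
rewrite sumr_const card_ord IH ?(ltnW lkn) //.
by rewrite ffactnSr natrM natrB ?(ltnW lkn) // -[X in _ - X]mulr_natl -mulrBl mulrC.
Qed.

End FrobeniusMaps.

(** * Frobenius maps of a sum of multiplicative maps *)

Section InjectionSums.
Variables (K : numFieldType) (A C : comAlgType K) (n : nat).
Variable sigma : 'I_n -> A -> C.
Hypothesis sigmaM : forall i a b, sigma i (a * b) = sigma i a * sigma i b.
Implicit Types (s : seq A) (U : {set 'I_n}).

(** [U] holds the indices already taken, so the recursion enumerates the injections from the
    positions of [s] into the complement of [U]. *)
Fixpoint inj_sum s U : C :=
  if s is a :: t then \sum_(i | i \notin U) sigma i a * inj_sum t (i |: U)
  else 1.

(* An index i not in U is either outside the range of the injection or hit by
   some j, in which case multiplicativity merges a into the j-th argument. *)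
Lemma mul_inj_sum a s U :
  (\sum_(i | i \notin U) sigma i a) * inj_sum s U =
  inj_sum (a :: s) U
  + \sum_(j < size s) inj_sum (set_nth 0 s j (a * s`_j)) U.
Proof.
elim: s U => [|b s IH] U /=.
  by rewrite big_ord0 addr0 mulr1; apply: eq_bigr => i _; rewrite mulr1.
rewrite big_ord_recl /= mulr_sumr.
(* With [l] the image of the head [b], either [i] equals [l] and [a] merges into [b], or [i] avoids
   [l |: U] and induction applies. *)
have splitU l : l \notin U ->
    (\sum_(i | i \notin U) sigma i a) * (sigma l b * inj_sum s (l |: U)) =
    \sum_(i | i \notin l |: U) sigma l b * (sigma i a * inj_sum s (i |: (l |: U)))
    + (sigma l (a * b) * inj_sum s (l |: U)
    + \sum_(j < size s)
        sigma l b * inj_sum (set_nth 0 s j (a * s`_j)) (l |: U)).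
  move=> lU; rewrite (bigD1 l lU) /= mulrDl addrCA; congr (_ + _).
    by rewrite sigmaM mulrA.
  rewrite -!mulr_sumr -mulrDr mulrCA -IH; congr (_ * (_ * _)).
  by apply: eq_bigl => i; rewrite !inE negb_or andbC.
rewrite (eq_bigr _ splitU) !big_split /=; congr (_ + (_ + _)).
  under [RHS]eq_bigr do rewrite mulr_sumr.
  rewrite (exchange_big_dep (fun i => i \notin U)) /=; last first.
    by move=> l i _; rewrite !inE negb_or => /andP[].
  apply: eq_bigr => i iU; apply: eq_big => l.
    by rewrite !inE !negb_or iU eq_sym andbT andbC.
  by move=> _; rewrite mulrCA setUCA.
by rewrite exchange_big.
Qed.

(** The correction terms in the Frobenius recursion are exactly those that [mul_inj_sum] produces
    for empty [U]. *)
Lemma Frob_sum k s : size s = k ->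
  Frob (fun a => \sum_i sigma i a) k s = inj_sum s set0.
Proof.
elim: k s => [|k IH] [|a s] //= [sz].
rewrite IH // (eq_bigl (fun i : 'I_n => i \notin set0)) => [|i]; last by rewrite inE.
rewrite mul_inj_sum [X in X + _]/= -addrA -[RHS]addr0; congr (_ + _).
rewrite -sumrB big1 // => j _.
by rewrite IH ?subrr // size_set_nth (maxn_idPr (ltn_ord j)).
Qed.

(** Pigeonhole: too few indices remain outside [U] for an injection. *)
Lemma inj_sum_eq0 s U : (n < size s + #|U|)%N -> inj_sum s U = 0.
Proof.
elim: s U => [|a s IH] U /=; first by rewrite ltnNge -[X in (_ <= X)%N](card_ord n) max_card.
move=> lt_n; apply: big1 => i iU.
by rewrite IH ?mulr0 // cardsU1 iU addnA addn1.
Qed.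

Lemma inj_sum_tuple k (x : k.-tuple A) U :
  inj_sum x U = \sum_(t : k.-tuple 'I_n | uniq t && all (fun i => i \notin U) t)
                  \prod_(j < k) sigma (tnth t j) (tnth x j).
Proof.
elim: k x U => [|k IH] x U.
  rewrite tuple0 (big_pred1 [tuple]) => [|t]; first by rewrite big_ord0.
  by rewrite tuple0 /= eqxx.
case/tupleP: x => a x /=.
under eq_bigr do rewrite IH mulr_sumr.
rewrite pair_big_dep /=.
rewrite (reindex (fun t : k.+1.-tuple 'I_n => (thead t, [tuple of behead t]))) /=; last first.
  exists (fun p => cons_tuple p.1 p.2) => [t _|[i t] _] /=.
    by rewrite [RHS]tuple_eta; apply: val_inj.
  by congr (_, _); apply: val_inj.
apply: eq_big => [t|t _].
  case/tupleP: t => i t; rewrite theadE /=.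
  have -> : all (fun l => l \notin i |: U) t =
            (i \notin (t : seq _)) && all (fun l => l \notin U) t.
    rewrite -has_pred1 -all_predC -all_predI; apply: eq_all => l.
    by rewrite /= !inE negb_or.
  rewrite -!andbA andbCA [RHS]andbCA; congr (_ && _).
  by rewrite andbCA.
case/tupleP: t => i t; rewrite big_ord_recl theadE !tnth0; congr (_ * _).
by apply: eq_bigr => j _; rewrite !tnthS; congr (sigma (tnth _ _) _); apply: val_inj.
Qed.

Lemma Frob_sum_perm (x : n.-tuple A) :
  Frob (fun a => \sum_i sigma i a) n x =
  \sum_(s : 'S_n) \prod_i sigma i (tnth x (s i)).
Proof.
rewrite Frob_sum ?size_tuple // inj_sum_tuple.
under eq_bigl => t do under eq_all do rewrite inE.
(* The inverse appears because the injection sends an argument to its slot, whereas [s] sends a slot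
   to its argument. *)
pose h (s : 'S_n) := [tuple s^-1%g j | j < n].
have h_inj : injective h.
  move=> s1 s2 e; apply/invg_inj/permP => j.
  by have := congr1 (fun t => tnth t j) e; rewrite !tnth_mktuple.
have Eh t : uniq (t : n.-tuple 'I_n) && all predT t = (t \in h @: setT).
  rewrite all_predT andbT; apply/tuple_uniqP/imsetP => [t_inj|[s _ ->] i j].
    exists (perm t_inj)^-1%g; rewrite ?inE //; apply: eq_from_tnth => j.
    by rewrite tnth_mktuple invgK permE.
  by rewrite !tnth_mktuple => /perm_inj.
rewrite (eq_bigl _ _ Eh) big_imset /=; last by move=> ? ? _ _; apply: h_inj.
apply: eq_big => [s|s _]; first by rewrite inE.
rewrite (reindex_inj (@perm_inj _ s)); apply: eq_bigr => i _.
by rewrite tnth_mktuple permK.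
Qed.

End InjectionSums.

(** * Elementary symmetric polynomials and Newton's identities *)

Lemma coef_prod_linear (C : comNzRingType) (I : Type) (r : seq I) (x : I -> C) :
  (\prod_(i <- r) (1 + (x i)%:P * 'X))`_(size r) = \prod_(i <- r) x i.
Proof.
(* The induction also needs the coefficients above the top degree to vanish. *)
suff gen k : (size r <= k)%N -> (\prod_(i <- r) (1 + (x i)%:P * 'X))`_k =
    if k == size r then \prod_(i <- r) x i else 0.
  by rewrite gen ?eqxx.
elim: r k => [|i r IH] k /=; first by rewrite !big_nil coef1; case: k.
case: k => // k ler; rewrite !big_cons mulrDl mul1r -mulrA coefD coefCM coefXM /=.
rewrite !IH ?leqW // eqSS (gtn_eqF (leq_trans ler _)) // add0r.
by case: eqP; rewrite ?mulr0.
Qed.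

Section NewtonElementary.
Variables (C : comNzRingType) (I : finType) (x : I -> C).

Let E := \prod_i (1 + (x i)%:P * 'X) : {poly C}.
Let E' i := \prod_(l | l != i) (1 + (x l)%:P * 'X) : {poly C}.

Lemma deriv_prod_linear : E^`() = \sum_i (x i)%:P * E' i.
Proof.
(* Product rule over any subset of indices, by induction on its size: removing a factor leaves a
   product of the same form. *)
have gen (P : pred I) : (\prod_(i | P i) (1 + (x i)%:P * 'X))^`() =
    \sum_(i | P i) (x i)%:P * \prod_(l | P l && (l != i)) (1 + (x l)%:P * 'X).
  have [m] := ubnP #|P|; elim: m P => // m IH P ltP.
  have [i0 Pi0|P0] := pickP P; last by rewrite !big_pred0 // -polyC1 derivC.
  rewrite (bigD1 i0) //= derivM derivD -polyC1 derivC add0r deriv_mulC derivX mulr1.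
  rewrite [RHS](bigD1 i0) //=; congr (_ + _).
  rewrite IH; last first.
    move: ltP; rewrite (cardD1 i0) unfold_in Pi0 add1n ltnS; apply: leq_trans.
    by apply/subset_leq_card/subsetP => l; rewrite !inE unfold_in andbC.
  rewrite mulr_sumr; apply: eq_bigr => i /andP[Pi ni].
  rewrite mulrCA; congr (_ * _); rewrite polyC1 [RHS](bigD1 i0) /=; last by rewrite Pi0 eq_sym.
  by congr (_ * _); apply: eq_bigl => l; rewrite andbAC.
by rewrite /E gen.
Qed.

(** [E' i] is [E] divided by 1 + x_i z, expanded as a geometric series. *)
Lemma coef_omit_factor i k : (E' i)`_k = \sum_(j < k.+1) (- x i) ^+ j * E`_(k - j).
Proof.
have EE' : E = E' i + (x i)%:P * ('X * E' i).
  by rewrite /E (bigD1 i) //= mulrDl mul1r mulrA.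
elim: k => [|k IH].
  rewrite big_ord1 subn0 expr0 mul1r EE' coefD coefCM coefXM /= mulr0 addr0 //.
rewrite big_ord_recl expr0 mul1r subn0 {1}EE' coefD coefCM coefXM /= IH.
rewrite mulr_sumr -addrA -big_split /= big1 ?addr0 // => j _.
by rewrite /bump leq0n add1n exprS subSS !mulNr -mulrA subrr.
Qed.

(** Coefficient of z^k in the derivative of [E]: summing the geometric series over [i] collects the
    power sums. *)
Lemma newton_elementary k :
  E`_k.+1 *+ k.+1 =
  \sum_(j < k.+1) (-1) ^+ j * (\sum_i x i ^+ j.+1) * E`_(k - j).
Proof.
rewrite -coef_deriv deriv_prod_linear coef_sum.
under eq_bigr do rewrite coefCM coef_omit_factor mulr_sumr.
rewrite exchange_big /=; apply: eq_bigr => j _.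
rewrite mulr_sumr mulr_suml; apply: eq_bigr => i _.
by rewrite mulrA [in LHS]exprNn mulrCA exprS.
Qed.

End NewtonElementary.

(** * Newton's recursion for the coefficients of the characteristic function *)

Section NewtonPsi.
Variables (K : numFieldType) (A B : comAlgType K) (phi : A -> B) (a : A).

Lemma coef_exp_lt (p : {poly B}) m i : p`_0 = 0 -> (i < m)%N -> (p ^+ m)`_i = 0.
Proof.
move=> p0; elim: m i => // m IH i ltim.
rewrite exprS coefM big_ord_recl p0 mul0r add0r big1 // => j _.
by rewrite IH ?mulr0 // lift0; have := ltn_ord j; lia.
Qed.

Lemma coef_exp_eq (p q : {poly B}) k m :
  (forall i, (i <= k)%N -> p`_i = q`_i) -> (p ^+ m)`_k = (q ^+ m)`_k.
Proof.
elim: m k => // m IH k epq; rewrite !exprS !coefM; apply: eq_bigr => j _.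
have ltj := ltn_ord j; rewrite epq; last by lia.
by rewrite (IH (k - j)%N) // => i lei; apply: epq; lia.
Qed.

Lemma psi0 : psi phi 0 a = 1.
Proof. by rewrite /psi big_ord1 expr0 coef1 /= invr1 scale1r. Qed.

(** [psi] truncates at its own index; a common truncation level [N] gives one polynomial to
    differentiate. *)
Definition exppoly N : {poly B} :=
  \sum_(m < N.+1) ((m`!%:R : K)^-1)%:A *: logpoly phi a N ^+ m.

Lemma coef_logpoly N i : (i <= N)%N -> (logpoly phi a N)`_i =
  if i == 0%N then 0 else ((-1) ^+ i.+1 / i%:R : K) *: phi (a ^+ i).
Proof. by rewrite -ltnS => lti; rewrite coef_poly lti. Qed.

(** The logarithm has no constant term, so powers above [k] do not reach degree [k], and the lower
    ones see only its coefficients up to [k]. *)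
Lemma coef_exppoly N k : (k <= N)%N -> (exppoly N)`_k = psi phi k a.
Proof.
move=> lekN; rewrite coef_sum /psi.
rewrite (big_ord_widen N.+1 (fun m => (m`!%:R : K)^-1 *: (logpoly phi a k ^+ m)`_k)) //.
rewrite [RHS]big_mkcond /=; apply: eq_bigr => m _; rewrite coefZ mulr_algl ltnS.
case: leqP => [_|ltkm]; last by rewrite coef_exp_lt ?scaler0 // coef_logpoly.
congr (_ *: _); apply: coef_exp_eq => i leik.
by rewrite !coef_logpoly // (leq_trans leik).
Qed.

(** The rule (exp L)' = L' exp L, where differentiating the truncated series loses its last term. *)
Lemma deriv_exppoly N : (exppoly N)^`() =
  (logpoly phi a N)^`() * (exppoly N - ((N`!%:R : K)^-1)%:A *: logpoly phi a N ^+ N).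
Proof.
rewrite /exppoly [in RHS]big_ord_recr /= addrK raddf_sum /= big_ord_recl /=.
rewrite expr0 -polyC1 derivZ derivC scaler0 add0r mulr_sumr.
apply: eq_bigr => m _; rewrite derivZ deriv_exp /bump leq0n add1n /=.
rewrite -[_ *+ m.+1]scaler_nat scalerA -scalerAr mulr_algl; congr (_ *: _).
rewrite -scalerMnr scalerMnl; congr (_ *: _).
by rewrite factS natrM invfM -mulr_natr mulrAC mulVf ?mul1r // pnatr_eq0.
Qed.

(** At level k + 1 the lost term has no coefficient in degree at most [k], so the rule for exp holds
    exactly there. *)
Lemma newton_psi k : psi phi k.+1 a *+ k.+1 =
  \sum_(j < k.+1) (-1) ^+ j * phi (a ^+ j.+1) * psi phi (k - j) a.
Proof.
rewrite -(coef_exppoly (leqnn k.+1)) -coef_deriv deriv_exppoly coefM.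
apply: eq_bigr => j _; rewrite coef_deriv coef_logpoly //=.
rewrite coefB coefZ mulr_algl coef_exp_lt ?coef_logpoly ?scaler0 ?subr0 //; last by lia.
rewrite coef_exppoly; last by lia.
rewrite -scaler_nat scalerA mulrCA mulfV ?pnatr_eq0 // mulr1.
(* The sign is a scalar in [K] on the left and an element of [B] on the right; both reduce to the
   parity of [j]. *)
by rewrite -scalerAl -mulrA -signr_odd -[in RHS]signr_odd /= negbK scaler_sign mulr_sign.
Qed.

End NewtonPsi.

Lemma scale_factV (K : numFieldType) (V : lmodType K) (v : V) m :
  (m`!%:R : K)^-1 *: (v *+ m`!) = v.
Proof. by rewrite -scaler_nat scalerK // pnatr_eq0 -lt0n fact_gt0. Qed.

(** * Slots, the permutation action and symmetric tensors *)

Section TensorPower.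
Variables (K : numFieldType) (A : comAlgType K) (n : nat) (TP : tensor_power A n).
Implicit Types (x y : n.-tuple A) (t u : TP) (s : 'S_n).

Lemma tnth_tupd x i a j : tnth (tupd x i a) j = if j == i then a else tnth x j.
Proof. by rewrite tnth_mktuple. Qed.

Lemma tupd_set_nth x i a : tupd x i a = set_nth 0 x i a :> seq A.
Proof.
have sz : size (set_nth 0 x i a) = n.
  by rewrite size_set_nth size_tuple; apply/maxn_idPr/ltn_ord.
apply: (@eq_from_nth _ 0) => [|j]; rewrite size_tuple ?sz // => ltjn.
rewrite nth_set_nth [RHS]/= -[j]/(nat_of_ord (Ordinal ltjn)) -!tnth_nth tnth_tupd.
by [].
Qed.

Lemma slot_tens i a x :
  slot TP i a * tp_tens TP x = tp_tens TP (tupd x i (a * tnth x i)).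
Proof.
rewrite -tp_mul; congr (tp_tens TP _); apply: eq_from_tnth => j.
by rewrite !tnth_mktuple; case: eqP => [->|] //; rewrite mul1r.
Qed.

Lemma slotM i a b : slot TP i (a * b) = slot TP i a * slot TP i b.
Proof.
rewrite [slot TP i b]/slot slot_tens; congr (tp_tens TP _).
by apply: eq_from_tnth => j; rewrite !tnth_tupd eqxx; case: eqP.
Qed.

Lemma slotX i a k : slot TP i (a ^+ k.+1) = slot TP i a ^+ k.+1.
Proof. by elim: k => // k IH; rewrite exprS slotM IH -exprS. Qed.

Lemma slot1 i : slot TP i 1 = 1.
Proof.
rewrite -(tp_one TP); congr (tp_tens TP _); apply: eq_from_tnth => j.
by rewrite tnth_tupd tnth_mktuple if_same.
Qed.

(** Turns the products of [Frob_sum_perm] into pure tensors. *)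
Lemma prod_slot x : \prod_i slot TP i (tnth x i) = tp_tens TP x.
Proof.
have gen (r : seq 'I_n) : \prod_(i <- r) slot TP i (tnth x i) =
    tp_tens TP [tuple \prod_(i <- r) (if j == i then tnth x i else 1) | j < n].
  elim: r => [|i r IH].
    rewrite big_nil -(tp_one TP); congr (tp_tens TP _); apply: eq_from_tnth => j.
    by rewrite !tnth_mktuple big_nil.
  rewrite big_cons IH -tp_mul; congr (tp_tens TP _); apply: eq_from_tnth => j.
  by rewrite !tnth_mktuple big_cons; case: eqP => // ->.
rewrite gen; congr (tp_tens TP _); apply: eq_from_tnth => j.
by rewrite tnth_mktuple -big_mkcond (big_pred1 j) // => i; rewrite eq_sym.
Qed.

Lemma tperm_tupd s x i a :
  Defs.tperm s (tupd x i a) = tupd (Defs.tperm s x) (s^-1%g i) a.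
Proof.
apply: eq_from_tnth => j; rewrite !(tnth_tupd, tnth_mktuple).
by rewrite (canF_eq (permK s)).
Qed.

(** [symmetric_tensor] quantifies over such [g]; their existence makes it a genuine invariance
    condition. *)
Lemma tens_tperm_lift s : exists g : {linear TP -> TP},
  forall x, g (tp_tens TP x) = tp_tens TP (Defs.tperm s x).
Proof.
apply: tp_universal_ex => i x c u v.
by rewrite !tperm_tupd tp_multilinear.
Qed.

Section PermutationAction.
Variables (s : 'S_n) (g : {linear TP -> TP}).
Hypothesis gE : forall x, g (tp_tens TP x) = tp_tens TP (Defs.tperm s x).

Lemma perm_act1 : g 1 = 1.
Proof.
rewrite -(tp_one TP) gE; congr (tp_tens TP _).
by apply: eq_from_tnth => j; rewrite !tnth_mktuple.
Qed.

Lemma perm_actM t u : g (t * u) = g t * g u.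
Proof.
have [c ->] := tp_span t; have [d ->] := tp_span u.
rewrite !mulr_suml !linear_sum /= mulr_suml; apply: eq_bigr => p _.
rewrite !mulr_sumr linear_sum; apply: eq_bigr => q _ /=.
rewrite -!scalerAr -!scalerAl !linearZ /= -scalerAr -scalerAl -tp_mul !gE -tp_mul.
do 2 congr (_ *: _); congr (tp_tens TP _).
by apply: eq_from_tnth => j; rewrite !tnth_mktuple.
Qed.

Lemma perm_act_slot i a : g (slot TP i a) = slot TP (s^-1%g i) a.
Proof.
rewrite /slot gE tperm_tupd; congr (tp_tens TP (tupd _ _ _)).
by apply: eq_from_tnth => j; rewrite !tnth_mktuple.
Qed.

End PermutationAction.

Lemma symmetric_tensor1 : symmetric_tensor (1 : TP).
Proof. by move=> s g /perm_act1. Qed.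

Lemma symmetric_tensorD t u :
  symmetric_tensor t -> symmetric_tensor u -> symmetric_tensor (t + u).
Proof. by move=> st su s g gE; rewrite linearD (st s) ?(su s). Qed.

Lemma symmetric_tensorZ (c : K) t : symmetric_tensor t -> symmetric_tensor (c *: t).
Proof. by move=> st s g gE; rewrite linearZ /= (st s). Qed.

Lemma symmetric_tensorM t u :
  symmetric_tensor t -> symmetric_tensor u -> symmetric_tensor (t * u).
Proof. by move=> st su s g gE; rewrite (perm_actM gE) (st s) ?(su s). Qed.

Lemma symmetric_tensor_sum (I : Type) (r : seq I) (P : pred I) (f : I -> TP) :
  (forall i, P i -> symmetric_tensor (f i)) ->
  symmetric_tensor (\sum_(i <- r | P i) f i).
Proof.
move=> sf; apply: big_ind => [| t u |//]; last exact: symmetric_tensorD.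
by rewrite -(scale0r 1); apply/symmetric_tensorZ/symmetric_tensor1.
Qed.

(** The map phi_0 of the overview; [phi_of F] is [F] composed with it. *)
Definition slot_sum a : TP := \sum_i slot TP i a.

Lemma slot_sum_linear : linear slot_sum.
Proof.
by move=> c a b; rewrite scaler_sumr -big_split; apply: eq_bigr => i _; apply: tp_multilinear.
Qed.

Lemma slot_sum1 : slot_sum 1 = n%:R.
Proof. by rewrite /slot_sum (eq_bigr _ (fun i _ => slot1 i)) sumr_const card_ord. Qed.

Lemma symmetric_slot_sum a : symmetric_tensor (slot_sum a).
Proof.
move=> s g gE; rewrite linear_sum /slot_sum [RHS](reindex_inj (@perm_inj _ s^-1%g)).
by apply: eq_bigr => i _; apply: perm_act_slot gE _ _.
Qed.

(** Built from the symmetric [slot_sum] by algebra operations. *)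
Lemma symmetric_Frob k (r : seq A) : symmetric_tensor (Frob slot_sum k r).
Proof.
elim: k r => [|k IH] [|a r] /=; try exact: symmetric_tensor1.
  by rewrite -(scale0r 1); apply/symmetric_tensorZ/symmetric_tensor1.
apply: symmetric_tensorD.
  by apply: symmetric_tensorM (IH _); apply: symmetric_slot_sum.
rewrite -scaleN1r; apply: symmetric_tensorZ.
by apply: symmetric_tensor_sum => j _; apply: IH.
Qed.

Lemma Frob_slot_sum_eq0 k (r : k.-tuple A) : (n < k)%N -> Frob slot_sum k r = 0.
Proof.
move=> ltnk; rewrite Frob_sum ?size_tuple //; last exact: slotM.
by rewrite inj_sum_eq0 // size_tuple cards0 addn0.
Qed.

(** Injections of n positions into n slots are permutations. Symmetrizations thus become polynomials
    in values of [slot_sum]. *)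
Lemma Symm_Frob x : Symm TP x = (n`!%:R : K)^-1 *: Frob slot_sum n x.
Proof.
rewrite Frob_sum_perm; last exact: slotM.
rewrite /Symm; congr (_ *: _); apply: eq_bigr => s _.
by rewrite -prod_slot; apply: eq_bigr => i _; rewrite tnth_mktuple.
Qed.

Lemma symmetric_Symm x : symmetric_tensor (Symm TP x).
Proof. by rewrite Symm_Frob; apply/symmetric_tensorZ/symmetric_Frob. Qed.

(** Averaging any expansion of [t] in pure tensors over all permutations fixes [t] and turns each
    pure tensor into its symmetrization. *)
Lemma symmetric_tensor_span t : symmetric_tensor t ->
  exists r : seq (K * n.-tuple A), t = \sum_(p <- r) p.1 *: Symm TP p.2.
Proof.
move=> st; have [r tE] := tp_span t; exists r.
have sE s : t = \sum_(p <- r) p.1 *: tp_tens TP (Defs.tperm s p.2).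
  have [g gE] := tens_tperm_lift s.
  rewrite -(st s g gE) {1}tE linear_sum; apply: eq_bigr => p _.
  by rewrite linearZ /= gE.
have : \sum_(s : 'S_n) t = n`!%:R *: t.
  by rewrite sumr_const card_Sn scaler_nat.
rewrite (eq_bigr _ (fun s _ => sE s)) exchange_big /= => e.
rewrite -[LHS](scale_factV _ n) -scaler_nat -e scaler_sumr; apply: eq_bigr => p _.
by rewrite -scaler_sumr scalerA mulrC -scalerA.
Qed.

Lemma detLambda_prod a :
  detLambda TP a = \prod_i (1 + (slot TP i a)%:P * 'X).
Proof.
rewrite /detLambda -diag_const_mx -raddfD det_diag.
by apply: eq_bigr => i _; rewrite !mxE.
Qed.

(** Slots are multiplicative, so their power sums are values of [slot_sum] at powers of [a]. *)
Lemma newton_detLambda a k : (detLambda TP a)`_k.+1 *+ k.+1 =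
  \sum_(j < k.+1) (-1) ^+ j * slot_sum (a ^+ j.+1) * (detLambda TP a)`_(k - j).
Proof.
rewrite detLambda_prod newton_elementary; apply: eq_bigr => j _.
by congr (_ * _ * _); apply: eq_bigr => i _; rewrite slotX.
Qed.

Lemma coef0_detLambda a : (detLambda TP a)`_0 = 1.
Proof.
rewrite detLambda_prod -horner_coef0 horner_prod big1 // => i _.
by rewrite !hornerE.
Qed.

Lemma coef_detLambda_n a : (detLambda TP a)`_n = tp_tens TP [tuple a | _ < n].
Proof.
have := coef_prod_linear (enum 'I_n) (fun i => slot TP i a).
rewrite size_enum_ord !big_enum -detLambda_prod => ->; rewrite -prod_slot.
by apply: eq_bigr => i _; rewrite tnth_mktuple.
Qed.

End TensorPower.

(** * From algebra homomorphisms to n-homomorphisms *)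

Section HomToFrobenius.
Variables (K : numFieldType) (A B : comAlgType K) (n : nat) (TP : tensor_power A n).
Variable F : TP -> B.
Hypothesis homF : symalg_hom F.

Lemma symalg_hom0 : F 0 = 0.
Proof.
case: homF => _ _ FZ _.
by rewrite -(scale0r 1) FZ ?scale0r //; apply: symmetric_tensor1.
Qed.

Lemma symalg_hom_sum (I : Type) (r : seq I) (P : pred I) (f : I -> TP) :
  (forall i, symmetric_tensor (f i)) ->
  F (\sum_(i <- r | P i) f i) = \sum_(i <- r | P i) F (f i).
Proof.
case: homF => _ FD _ _ sf; elim: r => [|i r IH].
  by rewrite !big_nil symalg_hom0.
rewrite !big_cons; case: ifP => // _; rewrite FD ?IH //.
exact: symmetric_tensor_sum.
Qed.

(** The Frobenius recursion uses only algebra operations on symmetric tensors, all preserved by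
    [F]. *)
Lemma symalg_hom_Frob k (r : seq A) :
  F (Frob (slot_sum TP) k r) = Frob (phi_of F) k r.
Proof.
case: homF => F1 FD FZ FM; elim: k r => [|k IH] [|a r] //=; first exact: symalg_hom0.
have sFrob := @symmetric_Frob _ _ _ TP.
have ssum : symmetric_tensor
    (\sum_(j < size r) Frob (slot_sum TP) k (set_nth 0 r j (a * r`_j))).
  by apply: symmetric_tensor_sum.
have sslot := @symmetric_slot_sum _ _ _ TP a.
rewrite -scaleN1r FD ?FZ ?FM //; last 2 first.
- exact: symmetric_tensorM.
- exact: symmetric_tensorZ.
rewrite scaleN1r IH [X in _ - X]symalg_hom_sum => [|j]; last exact: sFrob.
congr (_ - _).
by apply: eq_bigr => j _; rewrite IH.
Qed.

Lemma symalg_hom_Symm (x : n.-tuple A) :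
  F (Symm TP x) = (n`!%:R : K)^-1 *: Frob (phi_of F) n x.
Proof.
case: homF => _ _ FZ _; rewrite Symm_Frob FZ ?symalg_hom_Frob //.
exact: symmetric_Frob.
Qed.

Lemma phi_of_linear : linear (phi_of F).
Proof.
case: homF => _ FD FZ _ c a b; have ss := @symmetric_slot_sum _ _ _ TP.
rewrite /phi_of -/(slot_sum TP _) slot_sum_linear FD ?FZ //.
exact: symmetric_tensorZ.
Qed.

Lemma n_hom_phi_of : n_hom n (phi_of F).
Proof.
case: homF => F1 _ FZ _; split=> [|k ltnk r].
  rewrite /phi_of -/(slot_sum TP 1) slot_sum1 -scaler_nat FZ ?F1 ?scaler_nat //.
  exact: symmetric_tensor1.
by rewrite -symalg_hom_Frob Frob_slot_sum_eq0 // symalg_hom0.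
Qed.

Lemma char_identity_phi_of : char_identity (phi_of F) F.
Proof.
case: homF => F1 _ FZ FM a k.
(* Symmetry is carried through the induction because [F] respects products only on symmetric
   tensors. *)
suff [] : symmetric_tensor (detLambda TP a)`_k /\
          F (detLambda TP a)`_k = psi (phi_of F) k a by [].
have [m] := ubnP k; elim: m k => // m IH [|k] /ltnSE-lekm.
  by rewrite coef0_detLambda psi0 F1; split=> //; apply: symmetric_tensor1.
have IHj (j : 'I_k.+1) := IH (k - j)%N (leq_ltn_trans (leq_subr j k) lekm).
pose f (j : 'I_k.+1) := ((-1) ^+ j : K) *:
  (slot_sum TP (a ^+ j.+1) * (detLambda TP a)`_(k - j)).
have sf j : symmetric_tensor (f j).
  apply/symmetric_tensorZ/symmetric_tensorM; last by case: (IHj j).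
  exact: symmetric_slot_sum.
(* Newton's identity solved for the next coefficient, by dividing by k + 1 in [K]. *)
have dE : (detLambda TP a)`_k.+1 = (k.+1%:R : K)^-1 *: \sum_j f j.
  apply: (canRL (scalerK _)); first by rewrite pnatr_eq0.
  rewrite scaler_nat newton_detLambda; apply: eq_bigr => j _.
  by rewrite /f -mulrA -signr_odd -[in RHS]signr_odd scaler_sign mulr_sign.
have sS : symmetric_tensor (\sum_j f j) by apply: symmetric_tensor_sum.
split; first by rewrite dE; apply: symmetric_tensorZ.
rewrite dE FZ //; apply: (canLR (scalerK _)); first by rewrite pnatr_eq0.
rewrite scaler_nat newton_psi symalg_hom_sum //; apply: eq_bigr => j _.
have [sd <-] := IHj j; have ss := @symmetric_slot_sum _ _ _ TP (a ^+ j.+1).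
rewrite /f FZ ?FM //; last exact: symmetric_tensorM.
by rewrite -mulrA -signr_odd -[in RHS]signr_odd scaler_sign mulr_sign.
Qed.

End HomToFrobenius.

(** * Recovering phi from the characteristic identity *)

Lemma psi1 (K : numFieldType) (A B : comAlgType K) (phi : A -> B) a :
  psi phi 1 a = phi a.
Proof. by have := newton_psi phi a 0; rewrite big_ord1 psi0 expr0 mul1r mulr1 expr1. Qed.

Lemma eq_psi (K : numFieldType) (A B : comAlgType K) (phi phi' : A -> B) :
  phi =1 phi' -> forall k, psi phi k =1 psi phi' k.
Proof.
move=> e k a; have eL : logpoly phi a k = logpoly phi' a k.
  by apply/polyP => i; rewrite !coef_poly e.
by rewrite /psi eL.
Qed.

(** Compare the coefficients of z; both uniqueness claims rest on this. *)
Lemma char_identity_phi_ofE (K : numFieldType) (A B : comAlgType K) (n : nat)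
    (TP : tensor_power A n) (phi : A -> B) (F : TP -> B) :
  char_identity phi F -> phi =1 phi_of F.
Proof.
move=> cF a; rewrite -psi1 -cF /phi_of; congr F.
have := newton_detLambda TP a 0.
by rewrite big_ord1 coef0_detLambda expr0 mul1r mulr1 expr1.
Qed.

(** * From n-homomorphisms to algebra homomorphisms *)

Section FrobeniusToHom.
Variables (K : numFieldType) (A B : comAlgType K) (n : nat) (TP : tensor_power A n).
Variable phi : {linear A -> B}.
Hypothesis phi_n_hom : n_hom n phi.

Lemma Frob_multilinear : multilinear (fun x : n.-tuple A => Frob phi n x).
Proof.
move=> i x c u v; rewrite !tupd_set_nth Frob_linear_nth ?size_tuple //.
Qed.

(* The only use of Phi_(n+1) = 0. *)
Lemma mul_Frob_n a (x : n.-tuple A) :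
  phi a * Frob phi n x = \sum_i Frob phi n (tupd x i (a * tnth x i)).
Proof.
have [_ /(_ n.+1 (ltnSn n) [tuple of a :: x])] := phi_n_hom.
move=> /= /eqP; rewrite subr_eq0 => /eqP ->.
rewrite -(big_mkord xpredT (fun j => Frob phi n (set_nth 0 x j (a * x`_j)))).
rewrite size_tuple big_mkord; apply: eq_bigr => i _.
by rewrite tupd_set_nth (tnth_nth 0).
Qed.

Section LinearExtension.
Variable G : {linear TP -> B}.
Hypothesis GE : forall x, G (tp_tens TP x) = Frob phi n x.

(** On pure tensors, multiplying by slots multiplies single entries by [a], and the sum is that of
    [mul_Frob_n]. *)
Lemma mul_slot_sum a t : G (slot_sum TP a * t) = phi a * G t.
Proof.
have [r ->] := tp_span t; rewrite mulr_sumr !linear_sum mulr_sumr.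
apply: eq_bigr => p _; rewrite -scalerAr !linearZ /= -scalerAr; congr (_ *: _).
rewrite GE mul_Frob_n mulr_suml linear_sum; apply: eq_bigr => i _.
by rewrite slot_tens; apply: GE.
Qed.

(** The two Frobenius recursions run in parallel, [mul_slot_sum] extracting the head; [t] must vary
    in the induction. *)
Lemma mul_Frob_slot_sum k (r : seq A) t :
  G (Frob (slot_sum TP) k r * t) = Frob phi k r * G t.
Proof.
elim: k r t => [|k IH] [|a r] t /=; rewrite ?mul1r // ?mul0r ?raddf0 //.
rewrite !mulrBl linearB -mulrA mul_slot_sum IH mulrA; congr (_ - _).
by rewrite !mulr_suml linear_sum; apply: eq_bigr => j _; apply: IH.
Qed.

Lemma lift_one : G 1 = n`!%:R.
Proof.
case: phi_n_hom => phi1 _.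
rewrite -(tp_one TP) GE -ffactnn -(Frob_nseq1 phi1 (leqnn n)); congr Frob.
by apply: (@eq_from_nth _ 0) => [|i]; rewrite size_tuple ?size_nseq // => ltin;
   rewrite nth_nseq ltin -[i]/(nat_of_ord (Ordinal ltin)) nth_mktuple.
Qed.

Let F t := (n`!%:R : K)^-1 *: G t.

Lemma lift_Symm x : F (Symm TP x) = (n`!%:R : K)^-1 *: Frob phi n x.
Proof.
rewrite /F Symm_Frob linearZ /= -[Frob _ _ _]mulr1 mul_Frob_slot_sum lift_one.
by rewrite mulr_natr scale_factV.
Qed.

Lemma lift_SymmM x u : F (Symm TP x * u) = F (Symm TP x) * F u.
Proof.
rewrite lift_Symm /F Symm_Frob -scalerAl linearZ /= mul_Frob_slot_sum.
by rewrite -scalerAl -scalerAr.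
Qed.

Lemma symalg_hom_lift : symalg_hom F.
Proof.
have FD t u : F (t + u) = F t + F u by rewrite /F linearD scalerDr.
have FZ c t : F (c *: t) = c *: F t by rewrite /F linearZ /= !scalerA mulrC.
have F0 : F 0 = 0 by rewrite /F linear0 scaler0.
split=> [|t u _ _|c t _|t u st _] //; first by rewrite /F lift_one scale_factV.
(* Only the left factor is expanded: [lift_SymmM] allows any right factor. *)
have [r ->] := symmetric_tensor_span st.
rewrite mulr_suml !(big_morph F FD F0) mulr_suml; apply: eq_bigr => p _.
by rewrite -scalerAl !(FZ p.1) lift_SymmM scalerAl.
Qed.

Lemma phi_of_lift : phi_of F =1 phi.
Proof.
move=> a; rewrite /phi_of -/(slot_sum TP a) -[slot_sum _ _]mulr1 /F mul_slot_sum.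
by rewrite lift_one mulr_natr scale_factV.
Qed.

End LinearExtension.

Lemma n_hom_lift : exists2 F : TP -> B, symalg_hom F & phi_of F =1 phi.
Proof.
have [G GE] := tp_universal_ex TP Frob_multilinear.
by exists (fun t => (n`!%:R : K)^-1 *: G t);
  [apply: symalg_hom_lift | apply: phi_of_lift].
Qed.

End FrobeniusToHom.

(** * Assembling the two constructions into a bijection *)

Lemma linear_of (K : numFieldType) (U V : lmodType K) (f : U -> V) :
  linear f -> exists g : {linear U -> V}, g =1 f.
Proof.
by move=> lf; exists (HB.pack_for {linear U -> V} f (GRing.isLinear.Build K U V *:%R f lf)).
Qed.

Theorem mainTheorem10 (K : numFieldType) (A B : comAlgType K) (n : nat)
  (TP : tensor_power A n) :
  (0 < n)%N ->
  (* from phi to F *)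
  (forall phi : {linear A -> B}, n_hom n phi ->
     exists F : TP -> B,
       [/\ symalg_hom F,
           char_identity phi F,
           (forall F' : TP -> B, symalg_hom F' -> char_identity phi F' ->
              forall t : TP, symmetric_tensor t -> F' t = F t),
           (forall a : A, F (tp_tens TP [tuple a | _ < n]) = psi phi n a) &
           (forall x : n.-tuple A, F (Symm TP x) = (n`!%:R : K)^-1 *: Frob phi n x)])
  /\
  (* from F to phi *)
  (forall F : TP -> B, symalg_hom F ->
     exists phi : {linear A -> B},
       [/\ n_hom n phi,
           char_identity phi F,
           (forall a, phi a = phi_of F a) &
           (forall phi' : {linear A -> B}, n_hom n phi' -> char_identity phi' F ->
              forall a, phi' a = phi a)]).
Proof.
move=> _; split=> [phi hphi | F homF].
  have [F homF phiE] := n_hom_lift TP hphi.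
  have charF : char_identity phi F.
    by move=> a k; rewrite -(eq_psi phiE) (char_identity_phi_of homF).
  have SymmE (F' : TP -> B) : symalg_hom F' -> phi_of F' =1 phi ->
      forall x, F' (Symm TP x) = (n`!%:R : K)^-1 *: Frob phi n x.
    by move=> homF' e x; rewrite (symalg_hom_Symm homF') (eq_Frob e).
  exists F; split=> //; last exact: SymmE.
    (* The identity forces [phi_of F'] to be [phi], so [F'] and [F] agree on symmetrizations, which
       span. *)
    move=> F' homF' charF' t st; have [r ->] := symmetric_tensor_span st.
    have sS (p : K * n.-tuple A) : symmetric_tensor (p.1 *: Symm TP p.2).
      by apply/symmetric_tensorZ/symmetric_Symm.
    rewrite !symalg_hom_sum //; apply: eq_bigr => p _.
    have [[_ _ FZ _] [_ _ FZ' _]] := (homF, homF').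
    rewrite (FZ p.1) ?(FZ' p.1); try exact: symmetric_Symm.
    by rewrite !SymmE // => a; rewrite -(char_identity_phi_ofE charF').
  (* This is the characteristic identity in degree n. *)
  by move=> a; rewrite -coef_detLambda_n charF.
have [phi phiE] := linear_of (phi_of_linear homF).
have charF : char_identity phi F.
  by move=> a k; rewrite (eq_psi phiE) (char_identity_phi_of homF).
exists phi; split=> // [|phi' _ charF' a].
  have [phi1 phi0] := n_hom_phi_of homF.
  by split=> [|k ltnk s]; rewrite ?phiE ?(eq_Frob phiE) // phi0.
by rewrite phiE; apply: char_identity_phi_ofE.
Qed.
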